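(* Let $n$ be an odd positive integer. Then $MIP_n > n-1$ and $CE_n \ge n-1$, where $MIP_n$ is the maximum index of primitivity among primitive $n$-by-$n$ generalized doubly nonnegative matrices and $CE_n$ is the critical exponent for $n$-by-$n$ generalized doubly nonnegative matrices under continuous conventional powers.
   Context: A real $n$-by-$n$ matrix $A$ is called generalized doubly nonnegative (GDN) if it is entrywise nonnegative, diagonalizable, and all its eigenvalues are (real and) nonnegative. For a GDN matrix $A = SDS^{-1}$ with $D=\operatorname{diag}(\lambda_1,\dots,\lambda_n)$ diagonal, and a real number $\alpha>0$, the continuous (conventional) power is $A^\alpha := S D^\alpha S^{-1}$, where $D^\alpha := \operatorname{diag}(\lambda_1^\alpha,\dots,\lambda_n^\alpha)$ (with $0^\alpha = 0$). The critical exponent $CE_n$ is the least real number $m \ge 0$ such that for every $n$-by-$n$ GDN matrix $A$, the matrix $A^\alpha$ is GDN for all $\alpha > m$. An entrywise nonnegative square matrix $A$ is primitive if some positive integer power of $A$ is entrywise positive; its index of primitivity is the least positive integer $k$ such that $A^k$ is entrywise positive. $MIP_n$ denotes the maximum of the indices of primitivity of all primitive $n$-by-$n$ GDN matrices. *)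

(* Defs.v *)
From mathcomp Require Import all_boot all_order all_algebra.
From mathcomp Require Import all_classical all_reals all_analysis.

Set Implicit Arguments.
Unset Strict Implicit.
Unset Printing Implicit Defensive.

Import Order.TTheory GRing.Theory Num.Theory.
Local Open Scope classical_set_scope.
Local Open Scope ring_scope.

Definition nonneg_mx (R : realType) (n : nat) (A : 'M[R]_n) : Prop :=
  forall i j, 0 <= A i j.

Definition pos_mx (R : realType) (n : nat) (A : 'M[R]_n) : Prop :=
  forall i j, 0 < A i j.

(* [diagonalizable] is diagonalizability over the reals, which already forces
   every complex eigenvalue to be real, so that the last condition, on the real
   eigenvalues, covers all of them. *)
Definition GDN (R : realType) (n : nat) (A : 'M[R]_n) : Prop :=
  [/\ nonneg_mx A, diagonalizable A & forall a : R, eigenvalue A a -> 0 <= a].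

(* S D^alpha S^-1, for any real diagonalization A = S D S^-1 (0 if there is
   none). By [mxpowRE] below the choice of S and D is immaterial. *)
Definition mxpowR (R : realType) (n : nat) (A : 'M[R]_n) (alpha : R) : 'M[R]_n :=
  xget 0 [set B | exists (S : 'M[R]_n) (d : 'rV[R]_n),
    [/\ S \in unitmx,
        A = S *m diag_mx d *m invmx S &
        B = S *m diag_mx (map_mx (fun x => powR x alpha) d) *m invmx S]].

Lemma diag_fun_conj (R : realType) (n : nat) (f : R -> R)
    (S S' : 'M[R]_n) (d d' : 'rV[R]_n) :
  S \in unitmx -> S' \in unitmx ->
  S *m diag_mx d *m invmx S = S' *m diag_mx d' *m invmx S' ->
  S *m diag_mx (map_mx f d) *m invmx S =
  S' *m diag_mx (map_mx f d') *m invmx S'.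
Proof.
move=> uS uS' e.
pose T := invmx S' *m S.
have key : T *m diag_mx d = diag_mx d' *m T.
  have := congr1 (fun M => invmx S' *m M *m S) e.
  by rewrite /= !mulmxA mulVmx // mul1mx -!mulmxA mulVmx // mulmx1 !mulmxA.
have keyf : T *m diag_mx (map_mx f d) = diag_mx (map_mx f d') *m T.
  apply/matrixP => i j.
  move/matrixP: key => /(_ i j).
  rewrite !mul_mx_diag !mul_diag_mx !mxE => h.
  have [->|nz] := eqVneq (\sum_j0 invmx S' i j0 * S j0 j) 0.
    by rewrite mul0r mulr0.
  by move: h; rewrite mulrC => /(mulIf nz) ->; rewrite mulrC.
have := congr1 (fun M => S' *m M *m invmx S) keyf.
by rewrite /T /= !mulmxA mulmxV // mul1mx -!mulmxA mulmxV // mulmx1.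
Qed.

Lemma mxpowRE (R : realType) (n : nat) (A S : 'M[R]_n) (d : 'rV[R]_n)
    (alpha : R) :
  S \in unitmx -> A = S *m diag_mx d *m invmx S ->
  mxpowR A alpha =
  S *m diag_mx (map_mx (fun x => powR x alpha) d) *m invmx S.
Proof.
move=> uS AE; rewrite /mxpowR; case: xgetP => [B _ [S' [d' [uS' AE' ->]]]|].
  by apply: diag_fun_conj => //; rewrite -AE -AE'.
by move=> /(_ _)/(_ (ex_intro _ S (ex_intro _ d (And3 uS AE erefl)))).
Qed.

Definition CE_bound (R : realType) (n : nat) (m : R) : Prop :=
  0 <= m /\
  forall A : 'M[R]_n, GDN A ->
  forall alpha : R, m < alpha -> GDN (mxpowR A alpha).

(* "m = CE_n" *)
Definition is_CE (R : realType) (n : nat) (m : R) : Prop :=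
  CE_bound n m /\ forall m' : R, CE_bound n m' -> m <= m'.

Definition primitive_mx (R : realType) (n : nat) (A : 'M[R]_n) : Prop :=
  nonneg_mx A /\ exists k : nat, (0 < k)%N /\ pos_mx (A ^+ k).

Definition is_primitivity_index (R : realType) (n : nat) (A : 'M[R]_n)
    (k : nat) : Prop :=
  [/\ (0 < k)%N, pos_mx (A ^+ k) &
      forall l : nat, (0 < l)%N -> pos_mx (A ^+ l) -> (k <= l)%N].

(* "k = MIP_n" *)
Definition is_MIP (R : realType) (n : nat) (k : nat) : Prop :=
  (exists A : 'M[R]_n,
     [/\ GDN A, primitive_mx A & is_primitivity_index A k]) /\
  forall (A : 'M[R]_n) (l : nat),
    GDN A -> primitive_mx A -> is_primitivity_index A l -> (l <= k)%N.

(* Main.v *)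
(* Let n = 2r+1. Put loops of weights 0, 2, 2, 4, 4, .., 2r, 2r on the vertices
   of an n-cycle, one arc of which has weight 1/2 and the others weight 1. The
   eigenvalues are the solutions of x (x-2)^2 (x-4)^2 .. (x-2r)^2 = 1/2. At the
   integers 0, 1, .., n the left-hand side is alternately 0 and at least 1, so
   there is one solution in each interval (i, i+1), and the matrix A is GDN. The
   vertex without loop lies on no closed walk of length 1, .., n-1, hence its
   diagonal entry in A^x vanishes at x = 1, .., n-1, and A^(n-1) is not positive.

   For any GDN matrix the entries of A^x are exponential sums in x with n terms,
   which have at most n-1 zeros, counted with multiplicity. The entry above thus
   changes sign at n-1, which gives the lower bound on the critical exponent; the
   same bound on zeros shows that the critical exponent exists. *)
Require Import Defs.
From mathcomp Require Import all_boot all_order all_algebra.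
From mathcomp Require Import all_classical all_reals all_analysis.
From mathcomp Require Import ring lra zify.
Import Order.TTheory GRing.Theory Num.Theory.
Local Open Scope ring_scope.

Set Implicit Arguments.
Unset Strict Implicit.
Unset Printing Implicit Defensive.

(** * Zeros of real exponential sums *)

Definition expsum (R : realType) (s : seq (R * R)) (x : R) : R :=
  \sum_(p <- s) p.1 * expR (p.2 * x).

Lemma is_derive_expsum (R : realType) (s : seq (R * R)) (x : R) :
  is_derive x 1 (expsum s) (expsum [seq (p.1 * p.2, p.2) | p <- s] x).
Proof.
elim: s => [|p s IHs].
  rewrite (_ : expsum [::] = cst 0); last first.
    by apply/funext => y; rewrite /expsum big_nil.
  exact: is_derive_cst.
rewrite (_ : expsum (p :: s) = (p.1 *: (expR \o ( *%R p.2))) + expsum s); last first.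
  by apply/funext => y; rewrite /expsum big_cons.
rewrite /expsum /= big_cons -/(expsum _ x) /=.
have h : is_derive x 1 ( *%R p.2) p.2.
  have := is_deriveZ p.2 (is_derive_id x (1 : R)).
  by move/is_derive_eq; apply; rewrite /GRing.scale /= mulr1.
have {}h := is_derive1_comp (is_derive_expR (p.2 * x)) h.
have {}h := is_deriveZ p.1 h.
have {}h := is_deriveD h IHs.
apply: is_derive_eq; rewrite /GRing.scale /=; ring.
Qed.

Lemma expsum_twist (R : realType) (s : seq (R * R)) (a x : R) :
  expsum [seq (p.1, p.2 - a) | p <- s] x = expR (- a * x) * expsum s x.
Proof.
rewrite /expsum big_map mulr_sumr; apply: eq_bigr => p _ /=.
by rewrite mulrBl addrC -mulNr expRD; ring.
Qed.

(** The last clause keeps the Rolle points apart from the given zeros, so that a double zero can be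
    counted as one more zero of the derivative. *)
Lemma rolle_zeros (R : realType) (f df : R -> R) (x : R) (s : seq R) :
  (forall y : R, is_derive y 1 f (df y)) ->
  path <%R x s -> all (fun y => f y == 0) (x :: s) ->
  exists t : seq R, [/\ size t = size s, path <%R x t,
    all (fun y => df y == 0) t & all (fun y => y \notin x :: s) t].
Proof.
move=> fdf; elim: s x => [|y s IHs] x /=; first by move=> _ _; exists [::].
move=> /andP[xy ys] /and3P[fx fy fs].
have [|t [st yt dt nt]] := IHs y ys; first by rewrite /= fy.
have fab : f x = f y by rewrite (eqP fx) (eqP fy).
have [||c cxy dc] := Rolle xy _ _ fab.
- by move=> z _; have [] := fdf z.
- by apply: derivable_within_continuous => z _; have [] := fdf z.
move: cxy; rewrite in_itv /= => /andP[xc cy].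
have ltc (z : R) (u : seq R) : path <%R y u -> z \in u -> c < z.
  move=> /(order_path_min lt_trans)/allP h /h /=; exact: lt_trans.
exists (c :: t); split => /=.
- by rewrite st.
- rewrite xc /=; case: t {st dt nt} yt => //= z t /andP[yz ->].
  by rewrite (lt_trans cy yz).
- rewrite dt andbT; apply/eqP; have [_ <-] := fdf c; by have [] := dc.
- apply/andP; split.
    rewrite !inE !negb_or (gt_eqF xc) (lt_eqF cy) /=.
    by apply/negP => /(ltc _ _ ys); rewrite ltxx.
  apply/allP => z zt; move/allP: nt => /(_ z zt); rewrite !inE !negb_or => ->.
  rewrite andbT gt_eqF //; apply: lt_trans xc _; exact: ltc zt.
Qed.

(* Dividing by the exponential of one term and differentiating removes that
   term, so Rolle's theorem gives an induction on the number of terms. *)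
Lemma expsum_twist_derive (R : realType) (p : R * R) (s : seq (R * R)) :
  exists s' : seq (R * R), size s' = size s /\ forall x : R,
    is_derive x 1 (fun y => expR (- p.2 * y) * expsum (p :: s) y) (expsum s' x).
Proof.
pose u := [seq (q.1, q.2 - p.2) | q <- s].
exists [seq (q.1 * q.2, q.2) | q <- u]; split; first by rewrite !size_map.
move=> x.
have -> : (fun y => expR (- p.2 * y) * expsum (p :: s) y) =
    expsum ((p.1, p.2 - p.2) :: u).
  by apply/funext => y; rewrite -expsum_twist.
apply: is_derive_eq (is_derive_expsum _ _) _.
by rewrite /expsum /= big_cons /= subrr mulr0 mul0r add0r.
Qed.

Lemma expsum_twist_eq0 (R : realType) (p : R * R) (s s' : seq (R * R)) (y : R) :
  (forall x : R, is_derive x 1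
     (fun z => expR (- p.2 * z) * expsum (p :: s) z) (expsum s' x)) ->
  (forall x, expsum s' x = 0) -> expsum (p :: s) y = 0 ->
  forall x, expsum (p :: s) x = 0.
Proof.
move=> d d0 y0 x.
have := @is_derive_0_is_cst R _ x y (fun z : R => is_derive_eq (d z) (d0 z)).
by rewrite y0 mulr0 => /eqP; rewrite mulf_eq0 gt_eqF ?expR_gt0 //= => /eqP.
Qed.

Lemma uniq_sorted_path (R : realType) (t : seq R) : uniq t -> (0 < size t)%N ->
  exists x u, [/\ path <%R x u, x :: u =i t & (size u).+1 = size t].
Proof.
move=> ut t0; have := sort_lt_sorted t; have := mem_sort <=%R t.
have := size_sort <=%R t.
case: (sort _ t) => [/eqP|x u su mu su']; first by rewrite eq_sym -leqn0 leqNgt t0.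
by exists x, u; split => //; move: su'; rewrite ut.
Qed.

(** Repeated exponents and zero coefficients are allowed in [s], hence the conclusion is identical
    vanishing rather than a bound on the number of zeros. *)
Lemma expsum_zeros (R : realType) (s : seq (R * R)) (t : seq R) :
  uniq t -> (size s <= size t)%N -> (forall y, y \in t -> expsum s y = 0) ->
  forall x, expsum s x = 0.
Proof.
(* Induction on the length: the shorter sum [s'] is not the tail of the list. *)
have [n] := ubnP (size s); elim: n s t => // n IHn [|p s] t sn ut st t0.
  by move=> x; rewrite /expsum big_nil.
have [s' [ss' ds']] := expsum_twist_derive p s.
have [x [u [xu mxu sxu]]] := uniq_sorted_path ut (leq_trans (ltn0Sn _) st).
apply: (expsum_twist_eq0 ds' _ (t0 x _)); last by rewrite -mxu mem_head.
have [|v [sv xv v0 _]] := rolle_zeros ds' xu.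
  by apply/allP => y; rewrite mxu => /t0 ->; rewrite mulr0.
apply: (IHn s' v); first by rewrite ss'.
- by have := path_sorted xv; exact: lt_sorted_uniq.
- by rewrite ss' sv; move: st; rewrite -sxu.
- by move=> y yv; apply/eqP; move/allP: v0; apply.
Qed.

(** A double zero of the sum stays a double zero after twisting, so [y] joins the Rolle points as a
    further zero of the shorter sum [s']. *)
Lemma expsum_double_zero (R : realType) (s : seq (R * R)) (t : seq R) (y : R) :
  uniq t -> (size s <= (size t).+1)%N -> (forall z, z \in t -> expsum s z = 0) ->
  y \in t -> is_derive y 1 (expsum s) 0 -> forall x, expsum s x = 0.
Proof.
case: s => [|p s] ut st t0 yt dy; first by move=> x; rewrite /expsum big_nil.
have [s' [ss' ds']] := expsum_twist_derive p s.
have [x [u [xu mxu sxu]]] : exists x u,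
    [/\ path <%R x u, x :: u =i t & (size u).+1 = size t].
  by apply: uniq_sorted_path => //; case: (t) yt.
apply: (expsum_twist_eq0 ds' _ (t0 y yt)).
have [|v [sv xv v0 nv]] := rolle_zeros ds' xu.
  by apply/allP => z; rewrite mxu => /t0 ->; rewrite mulr0.
have s'y : expsum s' y = 0.
  have [_ <-] := ds' y.
  have h : is_derive y 1 (fun z => expR (- p.2 * z)) (- p.2 * expR (- p.2 * y)).
    have := is_derive_expsum [:: (1, - p.2)] y.
    rewrite /expsum /= big_cons big_nil /= addr0 mul1r.
    congr (is_derive _ _ _ _); apply/funext => z.
    by rewrite /expsum big_cons big_nil /= addr0 mul1r.
  have [_ ->] := is_deriveM h dy.
  by rewrite t0 // /GRing.scale /= mulr0 mul0r addr0.
apply: (@expsum_zeros _ s' (y :: v)).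
- rewrite /= (lt_sorted_uniq (path_sorted xv)) andbT.
  by apply/negP => /(allP nv); rewrite mxu yt.
- by rewrite ss' /= sv sxu.
- move=> z; rewrite inE => /predU1P[-> //|zv].
  by apply/eqP; move/allP: v0; apply.
Qed.

(** * Nonnegative matrices and the index of primitivity *)

Lemma nonneg_mulmx (R : realType) (n : nat) (A B : 'M[R]_n) :
  nonneg_mx A -> nonneg_mx B -> nonneg_mx (A *m B).
Proof.
by move=> A0 B0 i j; rewrite mxE; apply: sumr_ge0 => k _; apply: mulr_ge0.
Qed.

Lemma nonneg_exp (R : realType) (n : nat) (A : 'M[R]_n) (k : nat) :
  nonneg_mx A -> nonneg_mx (A ^+ k).
Proof.
move=> A0; elim: k => [|k IHk]; last by rewrite exprS; apply: nonneg_mulmx.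
by move=> i j; rewrite expr0 mxE ler0n.
Qed.

Lemma mulmx_gt0P (R : realType) (n : nat) (A B : 'M[R]_n) (i j : 'I_n) :
  nonneg_mx A -> nonneg_mx B ->
  reflect (exists2 k, 0 < A i k & 0 < B k j) (0 < (A *m B) i j).
Proof.
move=> A0 B0; rewrite mxE.
have AB0 k : true -> 0 <= A i k * B k j by move=> _; exact: mulr_ge0.
apply: (iffP idP) => [/gt_eqF/eqP/(psumr_neq0P AB0)[k]|[k Ak Bk]].
  rewrite /= => ABk; exists k.
    by rewrite lt0r A0 andbT; apply: contraTneq ABk => ->; rewrite mul0r ltxx.
  by rewrite lt0r B0 andbT; apply: contraTneq ABk => ->; rewrite mulr0 ltxx.
by rewrite (bigD1 k) //= ltr_wpDr ?mulr_gt0 ?sumr_ge0 // => l _; exact: AB0.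
Qed.

Lemma exp_gt0_trans (R : realType) (n : nat) (A : 'M[R]_n) (a b : nat)
    (i j k : 'I_n) : nonneg_mx A ->
  0 < (A ^+ a) i j -> 0 < (A ^+ b) j k -> 0 < (A ^+ (a + b)) i k.
Proof.
move=> A0 aij bjk; rewrite exprD; apply/mulmx_gt0P; try exact: nonneg_exp.
by exists j.
Qed.

Lemma gt0_pattern_exp (R : realType) (n : nat) (A B : 'M[R]_n) (k : nat) :
  nonneg_mx A -> nonneg_mx B -> (forall i j, (0 < A i j) = (0 < B i j)) ->
  forall i j, (0 < (A ^+ k) i j) = (0 < (B ^+ k) i j).
Proof.
move=> A0 B0 AB; elim: k => [|k IHk] i j; first by rewrite !expr0.
rewrite !exprS; apply/mulmx_gt0P/mulmx_gt0P; try exact: nonneg_exp; try by [].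
  by case=> l; rewrite AB IHk; exists l.
by case=> l; rewrite -AB -IHk; exists l.
Qed.

Lemma primitivity_index_exists (R : realType) (n : nat) (A : 'M[R]_n) :
  primitive_mx A -> exists k, is_primitivity_index A k.
Proof.
case=> _ [k0 [k0_gt0 Ak0]].
have exk : exists k, (0 < k)%N && `[< pos_mx (A ^+ k) >].
  by exists k0; rewrite k0_gt0; apply/asboolP.
case: (ex_minnP exk) => k /andP[k_gt0 /asboolP Ak] kmin.
exists k; split=> // l l_gt0 Al; apply: kmin; rewrite l_gt0; exact/asboolP.
Qed.

(* The index of primitivity depends only on the zero pattern, and there are
   finitely many patterns. *)
Lemma primitivity_index_bound (R : realType) (n : nat) :
  exists M : nat, forall (A : 'M[R]_n) (l : nat),
    nonneg_mx A -> is_primitivity_index A l -> (l <= M)%N.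
Proof.
pose pat (A : 'M[R]_n) : {ffun 'I_n * 'I_n -> bool} := [ffun p => 0 < A p.1 p.2].
have patP p : exists m : nat, forall (A : 'M[R]_n) (l : nat),
    nonneg_mx A -> is_primitivity_index A l -> pat A = p -> (l <= m)%N.
  have [[B [m [B0 [m_gt0 Bm _] Bp]]]|nop] := pselect (exists (B : 'M[R]_n) (m : nat),
      [/\ nonneg_mx B, is_primitivity_index B m & pat B = p]); last first.
    by exists 0%N => A l A0 Al Ap; case: nop; exists A, l.
  exists m => A l A0 [_ _ lmin] Ap; apply: lmin => // i j.
  rewrite (gt0_pattern_exp _ A0 B0); first exact: Bm.
  by move=> i' j'; have /ffunP/(_ (i', j')) := etrans Ap (esym Bp); rewrite !ffunE.
have [m mP] := choice patP.
exists (\max_p m p) => A l A0 Al.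
exact: leq_trans (mP (pat A) A l A0 Al erefl) (leq_bigmax _).
Qed.

Lemma MIP_exists (R : realType) (n : nat) (A : 'M[R]_n) (k : nat) :
  GDN A -> primitive_mx A -> is_primitivity_index A k ->
  exists M, is_MIP R n M.
Proof.
move=> GA prA kA; have [M MP] := primitivity_index_bound R n.
pose P l := `[< exists A : 'M[R]_n,
     [/\ GDN A, primitive_mx A & is_primitivity_index A l] >].
have exP : exists l, P l by exists k; apply/asboolP; exists A.
have ubP l : P l -> (l <= M)%N.
  by move=> /asboolP[B [[B0 _ _] _]]; exact: MP.
case: (ex_maxnP exP ubP) => m /asboolP mP mmax; exists m; split=> // B l GB pB lB.
by apply: mmax; apply/asboolP; exists B.
Qed.

(** * Diagonalization and real powers of GDN matrices *)

Lemma conj_diag_entry (R : realType) (n : nat) (S : 'M[R]_n) (d : 'rV[R]_n)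
    (i j : 'I_n) :
  (S *m diag_mx d *m invmx S) i j = \sum_k S i k * invmx S k j * d 0 k.
Proof.
rewrite mul_mx_diag mxE; apply: eq_bigr => k _.
by rewrite mxE -mulrA [d 0 k * _]mulrC mulrA.
Qed.

Lemma GDN_conj (R : realType) (n : nat) (S : 'M[R]_n) (d : 'rV[R]_n) :
  S \in unitmx -> (forall k, 0 <= d 0 k) ->
  nonneg_mx (S *m diag_mx d *m invmx S) -> GDN (S *m diag_mx d *m invmx S).
Proof.
move=> uS d0 A0; split=> //.
  exists (invmx S); first by rewrite unitmx_inv.
  apply/similar_diagLR; first by rewrite unitmx_inv.
  by exists d; rewrite invmxK conjumx.
move=> a /eigenvalueP[v vA v0].
(* [v *m S] is a left eigenvector of [diag_mx d]; any nonzero coordinate of it identifies [a] with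
   an entry of [d]. *)
have vS0 : v *m S != 0.
  by apply: contra_neq v0 => vS; rewrite -[v](mulmxK uS) vS mul0mx.
have : (v *m S) *m diag_mx d = a *: (v *m S).
  by rewrite scalemxAl -vA !mulmxA mulmxKV.
move=> /matrixP vSd; have [k vSk] : exists k, (v *m S) 0 k != 0.
  apply/existsP; apply: contraR vS0; rewrite negb_exists => /forallP h.
  by apply/eqP/rowP => k; rewrite (eqP (negPn (h k))) mxE.
have := vSd 0 k; rewrite mul_mx_diag [LHS]mxE [RHS]mxE mulrC.
by move=> /(mulIf vSk) <-.
Qed.

Lemma GDN_decomp (R : realType) (n : nat) (A : 'M[R]_n) : GDN A ->
  exists (S : 'M[R]_n) (d : 'rV[R]_n),
    [/\ S \in unitmx, A = S *m diag_mx d *m invmx S & forall k, 0 <= d 0 k].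
Proof.
case=> _ [P uP /(similar_diagLR uP)[d Ad]] eig.
have uP' : invmx P \in unitmx by rewrite unitmx_inv.
rewrite conjumx // invmxK in Ad.
exists (invmx P), d; split; rewrite ?invmxK // => k.
(* The rows of [P], the inverse of the diagonalizing matrix, are left eigenvectors of [A]. *)
apply: eig; apply/eigenvalueP; exists (row k P); last first.
  apply: contraTneq uP => Pk; rewrite -row_free_unit -kermx_eq0.
  apply/negP => /eqP kP; have : delta_mx 0 k *m P = 0 :> 'rV_n by rewrite -rowE.
  move=> /sub_kermxP; rewrite kP submx0 => /eqP/matrixP/(_ 0 k).
  by rewrite !mxE !eqxx => /eqP; rewrite oner_eq0.
rewrite Ad !mulmxA -row_mul mulmxV // row1 -!mulmxA [delta_mx _ _ *m (_ *m _)]mulmxA.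
have -> : delta_mx 0 k *m diag_mx d = d 0 k *: delta_mx 0 k :> 'rV_n.
  apply/rowP => j; rewrite mul_mx_diag !mxE eqxx /= mulrC.
  by case: eqVneq => [->|]; rewrite ?mulr0.
by rewrite -scalemxAl -rowE.
Qed.

Lemma GDN_mxpowR (R : realType) (n : nat) (A : 'M[R]_n) (x : R) :
  GDN A -> nonneg_mx (mxpowR A x) -> GDN (mxpowR A x).
Proof.
move=> /GDN_decomp[S [d [uS AE d0]]]; rewrite (mxpowRE _ uS AE).
by apply: GDN_conj => // k; rewrite mxE powR_ge0.
Qed.

Lemma mxpowR_nat (R : realType) (n : nat) (A : 'M[R]_n) (k : nat) :
  GDN A -> mxpowR A k%:R = A ^+ k.
Proof.
move=> /GDN_decomp[S [d [uS AE d0]]]; rewrite (mxpowRE _ uS AE).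
rewrite (_ : map_mx _ d = \row_i (d 0 i ^+ k)); last first.
  by apply/rowP => i; rewrite !mxE powR_mulrn.
elim: k => [|k IHk].
  rewrite (_ : diag_mx _ = 1%:M) ?mulmx1 ?mulmxV //.
  by apply/matrixP => i j; rewrite !mxE expr0.
rewrite exprS -IHk {1}AE; change (GRing.mul ?x ?y) with (x *m y).
rewrite !mulmxA mulmxKV // -[in RHS](mulmxA S) mulmx_diag.
by congr (_ *m diag_mx _ *m _); apply/rowP => i; rewrite !mxE exprS.
Qed.

Lemma mxpowRD (R : realType) (n : nat) (A : 'M[R]_n) (x y : R) :
  GDN A -> 0 < x -> 0 <= y ->
  mxpowR A (x + y) = mxpowR A x *m mxpowR A y.
Proof.
move=> /GDN_decomp[S [d [uS AE d0]]] x0 y0; rewrite !(mxpowRE _ uS AE).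
rewrite !mulmxA mulmxKV // -[in RHS](mulmxA S) mulmx_diag.
congr (_ *m diag_mx _ *m _); apply/rowP => i; rewrite !mxE powRD //.
by rewrite gt_eqF ?ltr_wpDr.
Qed.

Lemma mxpowR_expsum (R : realType) (n : nat) (A : 'M[R]_n) (i j : 'I_n) :
  GDN A -> exists s : seq (R * R),
    size s = n /\ forall x, 0 < x -> mxpowR A x i j = expsum s x.
Proof.
move=> /GDN_decomp[S [d [uS AE d0]]].
(* Exponents are logarithms of eigenvalues. A zero eigenvalue contributes 0 for x > 0; its term is
   kept with coefficient 0, so that there are exactly n terms. *)
exists [seq (if d 0 k == 0 then 0 else S i k * invmx S k j, ln (d 0 k)) |
  k <- enum 'I_n]; split=> [|x x0]; first by rewrite size_map size_enum_ord.
rewrite (mxpowRE _ uS AE) conj_diag_entry /expsum big_map big_enum /=.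
apply: eq_bigr => k _; rewrite mxE /powR (gt_eqF x0).
by case: ifP; rewrite ?mulr0 ?mul0r // [ln _ * x]mulrC.
Qed.

(** * The critical exponent: existence and a lower bound *)

Lemma large_fibre (T U : finType) (g : T -> U) (m : nat) :
  (#|U| * m < #|T|)%N -> exists u, (m < #|[set t | g t == u]|)%N.
Proof.
move=> UT; apply/existsP; apply: contraTT UT; rewrite negb_exists => /forallP h.
rewrite -leqNgt -sum1_card (partition_big g predT) //=.
rewrite -sum_nat_const; apply: leq_sum => u _.
by rewrite sum1dep_card leqNgt.
Qed.

Lemma expsum_IVT (R : realType) (s : seq (R * R)) (a b : R) :
  a <= b -> expsum s a < 0 -> 0 <= expsum s b ->
  exists2 z, a < z <= b & expsum s z = 0.
Proof.
move=> ab sa sb.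
have [||z] := @IVT R (expsum s) a b 0 ab.
- apply: derivable_within_continuous => y _.
  by have [] := is_derive_expsum s y.
- by rewrite ge_min le_max (ltW sa) sb orbT.
rewrite in_itv /= => /andP[az zb] sz; exists z => //.
rewrite zb andbT lt_neqAle az andbT; apply: contraTneq sa => ->.
by rewrite sz ltxx.
Qed.

(* [A^alpha] is the product of some [A^beta], with [beta] in the interval, and a
   natural power of [A]. *)
Lemma mxpowR_neg_unit (R : realType) (n : nat) (A : 'M[R]_n) (alpha : R) (k : nat) :
  GDN A -> k.+1%:R <= alpha -> ~ nonneg_mx (mxpowR A alpha) ->
  exists (beta : R) (i j : 'I_n),
    k.+1%:R <= beta < k.+2%:R /\ mxpowR A beta i j < 0.
Proof.
move=> GA ka nA; have a0 : 0 <= alpha by apply: le_trans ka.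
have /andP[la al] := truncn_itv a0; set l := Num.truncn alpha in la al.
have kl : (k.+1 <= l)%N by rewrite truncn_ge_nat.
pose beta := alpha - (l - k.+1)%:R.
have kb : k.+1%:R <= beta < k.+2%:R.
  rewrite /beta natrB // -[k.+2%:R]natr1 in al *; move: al; rewrite -!natr1; lra.
have b0 : 0 < beta by apply: lt_le_trans (proj1 (andP kb)); rewrite ltr0n.
have abE : alpha = beta + (l - k.+1)%:R by rewrite /beta subrK.
have nb : ~ nonneg_mx (mxpowR A beta).
  move=> B0; apply: nA; rewrite abE mxpowRD // mxpowR_nat //.
  by apply: nonneg_mulmx => //; apply: nonneg_exp; case: GA.
have [[i [j ij]]|no] := pselect (exists i j, mxpowR A beta i j < 0).
  by exists beta, i, j.
by case: nb => i j; rewrite leNgt; apply/negP => ij; apply: no; exists i, j.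
Qed.

(* The entries of [A^x] are exponential sums with [n] terms, hence have fewer
   than [n] zeros; a negative entry of [A^alpha] would produce a zero of some
   entry in each of the intervals (k+1, k+2] with [k < n^3]. *)
Lemma CE_bound_exists (R : realType) (n : nat) :
  CE_bound n ((n * n * n)%:R : R).
Proof.
split; first by rewrite ler0n.
move=> A GA alpha Na; apply: GDN_mxpowR => //.
have [n0|n0] := posnP n; first by move=> i; have := ltn_ord i; rewrite {2}n0.
apply: contrapT => nA.
(* For each k, record an entry, a point where it is negative, and a later zero, which exists because
   the natural power at k+2 is nonnegative. *)
have zP (k : 'I_(n * n * n)) : exists p : ('I_n * 'I_n) * (R * R),
    [/\ k.+1%:R < p.2.2 <= k.+2%:R, mxpowR A p.2.2 p.1.1 p.1.2 = 0,
        0 < p.2.1 & mxpowR A p.2.1 p.1.1 p.1.2 < 0].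
  have [|beta [i [j [/andP[kb bk] neg]]]] := @mxpowR_neg_unit _ _ _ _ k GA _ nA.
    by apply: le_trans (ltW Na); rewrite ler_nat.
  have b0 : 0 < beta by apply: lt_le_trans kb; rewrite ltr0n.
  have [s [_ sE]] := mxpowR_expsum i j GA.
  have [||z /andP[bz zk] sz] := expsum_IVT (ltW bk) (s := s).
  - by rewrite -sE.
  - by rewrite -sE ?ltr0n // mxpowR_nat //; apply: nonneg_exp; case: GA.
  have z0 : 0 < z by apply: lt_trans bz.
  by exists ((i, j), (beta, z)); rewrite /= sE // (le_lt_trans kb bz).
have [w wP] := choice zP.
(* Pigeonhole: n^3 zeros distributed over n^2 entries give some entry at least n of them. *)
have [|[i j] fib] := @large_fibre _ _ (fun k => (w k).1) n.-1.
  by rewrite card_prod !card_ord ltn_pmul2l ?muln_gt0 ?n0 // prednK.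
have [s [ss sE]] := mxpowR_expsum i j GA.
pose F := [set k | (w k).1 == (i, j)]%SET.
have z_inj : injective (fun k => (w k).2.2).
  move=> k l; have [/andP[k1 k2] _ _ _] := wP k; have [/andP[l1 l2] _ _ _] := wP l.
  move=> /= kl; rewrite kl in k1 k2; apply/val_inj => /=.
  have := lt_le_trans k1 l2; have := lt_le_trans l1 k2.
  by rewrite !ltr_nat; lia.
have s0 : forall x, expsum s x = 0.
  apply: (@expsum_zeros _ s [seq (w k).2.2 | k <- enum F]).
  - by rewrite map_inj_uniq ?enum_uniq.
  - by rewrite size_map -cardE ss; move: fib; rewrite -/F; lia.
  - move=> y /mapP[k]; rewrite mem_enum inE => /eqP kij ->.
    have [/andP[k1 _] <- _ _] := wP k; rewrite kij sE //.
    by apply: lt_trans k1; rewrite ltr0n.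
have /card_gt0P[k] : (0 < #|F|)%N by apply: leq_ltn_trans fib.
rewrite inE => /eqP kij; have [_ _ b0] := wP k.
by rewrite kij sE // s0 ltxx.
Qed.

(** The infimum of all bounds is itself a bound, since [CE_bound] concerns only exponents strictly
    above m: each exponent above the infimum exceeds some bound. *)
Lemma CE_exists (R : realType) (n : nat) : exists m : R, is_CE n m.
Proof.
pose E := [set m : R | CE_bound n m]%classic.
have E0 : lbound E 0 by move=> m [].
have Ene : (E !=set0)%classic by exists (n * n * n)%:R; exact: CE_bound_exists.
exists (inf E); split; last by move=> m Em; apply: ge_inf => //; exists 0.
split; first exact: lb_le_inf.
move=> A GA alpha ia.
have [||m [_ mE]] := @inf_adherent _ E (alpha - inf E).
- by rewrite subr_gt0.
- by split=> //; exists 0.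
by rewrite addrC subrK; exact: mE.
Qed.

(* The entry has the n-1 zeros 1, .., n-1. If it were nonnegative to the right
   of some [m < n-1], then n-1 would be a double zero: one zero too many. *)
Lemma CE_bound_ge (R : realType) (n : nat) (A : 'M[R]_n) (i j : 'I_n) (k0 : nat)
    (m : R) : (1 < n)%N -> GDN A ->
  (forall k, (0 < k < n)%N -> (A ^+ k) i j = 0) ->
  (0 < k0)%N -> (A ^+ k0) i j != 0 -> CE_bound n m -> n%:R - 1 <= m.
Proof.
move=> n1 GA A0 k0_gt0 Ak0 [m0 mB]; rewrite leNgt; apply/negP => mn.
have nE : n%:R - 1 = n.-1%:R :> R by rewrite -[in LHS](prednK (ltnW n1)) -natr1 addrK.
rewrite nE in mn.
have [s [ss sE]] := mxpowR_expsum i j GA.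
have sk k : (0 < k)%N -> expsum s k%:R = (A ^+ k) i j.
  by move=> k_gt0; rewrite -sE ?ltr0n // mxpowR_nat.
have n1_gt0 : (0 < n.-1)%N by rewrite -ltnS prednK // ltnW.
have sn : expsum s n.-1%:R = 0 by rewrite sk // A0 // n1_gt0 /= prednK // ltnW.
(* If m bounds, the entry is nonnegative on (m, n), so its zero n-1 is an interior minimum. *)
have d0 : is_derive (n.-1%:R : R) 1 (expsum s) 0.
  apply: (@derive1_at_min _ _ m n%:R).
  - by apply: le_trans (ltW mn) _; rewrite ler_nat leq_pred.
  - by move=> t _; have [] := is_derive_expsum s t.
  - by rewrite in_itv /= mn ltr_nat; lia.
  - move=> t; rewrite in_itv /= => /andP[mt _].
    rewrite sn -sE ?(le_lt_trans m0) //.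
    by have [B0 _ _] := mB _ GA _ mt; exact: B0.
have := @expsum_double_zero _ s [seq (k%:R : R) | k <- iota 1 n.-1] n.-1%:R.
move=> s0; move: Ak0; rewrite -sk // s0 ?eqxx //.
- by rewrite map_inj_uniq ?iota_uniq // => a b /eqP; rewrite eqr_nat => /eqP.
- by rewrite size_map size_iota prednK ?ss // ltnW.
- move=> z /mapP[k]; rewrite mem_iota => kn ->.
  by rewrite sk ?A0 //; lia.
- by apply: map_f; rewrite mem_iota; lia.
Qed.

(** * The weighted cycle with loops *)

(* The entry (i, j) is the weight of the arc from j to i; the loop at j has
   weight 2 * ceil(j / 2). *)
Definition loop_cycle (R : realType) (r : nat) : 'M[R]_(r.*2.+1) :=
  \matrix_(i, j) ((uphalf j).*2%:R *+ (i == j)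
                  + (if j == ord_max then 2^-1 else 1) *+ (i == ordS j)).

(** For k = n this is the characteristic polynomial of [loop_cycle] plus 1/2; for k < n it gives the
    coordinates of a left eigenvector. *)
Definition loop_prod (R : realType) (k : nat) (x : R) : R :=
  \prod_(l < k) (x - (uphalf l).*2%:R).

(** Every factor is an odd integer, hence of absolute value at least 1; all but the positive first
    one pair up into squares. *)
Lemma loop_prod_odd (R : realType) (r i : nat) :
  odd i -> 1 <= loop_prod r.*2.+1 (i%:R : R).
Proof.
move=> oi; elim: r => [|r IHr].
  by rewrite /loop_prod big_ord1 subr0 ler1n; case: i oi.
have -> : loop_prod r.+1.*2.+1 (i%:R : R) =
    loop_prod r.*2.+1 i%:R * (i%:R - r.+1.*2%:R) ^+ 2.
  rewrite /loop_prod doubleS 2!big_ord_recr /= -mulrA expr2.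
  by congr (_ * ((_ - _%:R) * (_ - _%:R))); lia.
apply: mulr_ege1 => //; rewrite -real_normK ?num_real // expr_ge1 //.
have [ir|ir] := leqP i r.+1.*2.
  rewrite ler0_norm ?subr_le0 ?ler_nat // opprB -natrB // ler1n.
  by lia.
by rewrite ger0_norm ?subr_ge0 ?ler_nat -?natrB ?ler1n //; lia.
Qed.

Lemma loop_prod_even (R : realType) (k i : nat) :
  ~~ odd i -> (i < k)%N -> loop_prod k (i%:R : R) = 0.
Proof.
move=> ei ik; rewrite /loop_prod (bigD1 (Ordinal ik)) //=.
by rewrite (_ : (uphalf i).*2 = i) ?subrr ?mul0r //; lia.
Qed.

Lemma loop_prod_root (R : realType) (r : nat) (i : 'I_(r.*2.+1)) :
  exists x : R, i%:R < x < i.+1%:R /\ loop_prod r.*2.+1 x = 2^-1.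
Proof.
pose q : {poly R} := \prod_(l < r.*2.+1) ('X - (uphalf l).*2%:R%:P) - (2^-1)%:P.
have qE x : q.[x] = loop_prod r.*2.+1 x - 2^-1.
  rewrite /q hornerD hornerN hornerC horner_prod; congr (_ - _).
  by apply: eq_bigr => l _; rewrite hornerXsubC.
have i1 : (i%:R : R) <= i.+1%:R by rewrite ler_nat.
have half : (0 : R) < 2^-1 by rewrite invr_gt0.
have half1 : (2^-1 : R) < 1 by rewrite invf_lt1 // ltr1n.
(* At integers the product is 0 or at least 1, so the root found below is never an endpoint. *)
have nat_neq (k : nat) : (k <= r.*2.+1)%N -> loop_prod r.*2.+1 (k%:R : R) != 2^-1.
  move=> kr; have [ok|ek] := boolP (odd k).
    by rewrite gt_eqF // (lt_le_trans half1) ?loop_prod_odd.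
  by rewrite loop_prod_even ?lt_eqF //; lia.
have [x /andP[ix xi] qx] : exists2 x, i%:R <= x <= i.+1%:R & root q x.
  have [oi|ei] := boolP (odd i).
    (* For odd i the sign of [q] goes from plus to minus, hence [- q]. An odd i is below 2r, so the
       product does vanish at i+1. *)
    have [|x xi] := @poly_ivt R (- q) _ _ i1; last by rewrite rootN; exists x.
    rewrite !hornerN !qE !oppr_le0 !oppr_ge0 subr_ge0 subr_le0.
    rewrite (le_trans (ltW half1)) ?loop_prod_odd //=.
    have [ir|ir] := ltnP i.+1 r.*2.+1; last by have := ltn_ord i; lia.
    by rewrite loop_prod_even ?ltW // /= oi.
  apply: (@poly_ivt R q _ _ i1).
  rewrite !qE subr_ge0 subr_le0 loop_prod_even ?(ltW half) //=.
  by rewrite (le_trans (ltW half1)) ?loop_prod_odd.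
have px : loop_prod r.*2.+1 x = 2^-1.
  by apply/eqP; rewrite -subr_eq0 -qE.
exists x; split=> //; rewrite !lt_neqAle ix xi !andbT.
apply/andP; split; apply/eqP => xE.
  by have := nat_neq i (ltnW (ltn_ord i)); rewrite xE px eqxx.
by have := nat_neq i.+1 (ltn_ord i); rewrite -xE px eqxx.
Qed.

Lemma loop_cycle_nonneg (R : realType) (r : nat) : nonneg_mx (loop_cycle R r).
Proof.
move=> i j; rewrite mxE addr_ge0 // mulrn_wge0 //; case: ifP => // _.
Qed.

(** The partial products form a left eigenvector: column j reads as the recursion from one product
    to the next, and the last column closes the cycle because the full product is 1/2. *)
Lemma loop_cycle_eigenvalue (R : realType) (r : nat) (x : R) :
  loop_prod r.*2.+1 x = 2^-1 -> eigenvalue (loop_cycle R r) x.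
Proof.
move=> px; apply/eigenvalueP; exists (\row_i loop_prod i x); last first.
  apply/eqP => /rowP/(_ ord0); rewrite !mxE /loop_prod big_ord0.
  by apply/eqP; rewrite oner_eq0.
apply/rowP => j; rewrite !mxE.
under eq_bigr => i _ do rewrite !mxE mulrDr.
rewrite big_split /= (bigD1 j) //= eqxx big1 ?addr0 => [|i /negPf->]; last first.
  by rewrite mulr0.
rewrite (bigD1 (ordS j)) //= eqxx big1 ?addr0 => [|i /negPf->]; last first.
  by rewrite mulr0.
have pS : loop_prod j.+1 x = loop_prod j x * (x - (uphalf j).*2%:R).
  by rewrite /loop_prod big_ord_recr.
suff -> : loop_prod (j.+1 %% r.*2.+1) x * (if j == ord_max then 2^-1 else 1) =
    loop_prod j.+1 x by rewrite pS; ring.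
case: eqVneq => [->|jm] /=.
  by rewrite modnn /loop_prod big_ord0 mul1r -/(loop_prod _ _) px.
rewrite mulr1 modn_small // ltnS ltn_neqAle -ltnS ltn_ord andbT.
exact: jm.
Qed.

(** The n roots lie in disjoint intervals, so the characteristic polynomial has n distinct
    nonnegative roots. *)
Lemma loop_cycle_GDN (R : realType) (r : nat) : GDN (loop_cycle R r).
Proof.
have [x xP] := choice (@loop_prod_root R r).
pose rs := [seq x i | i <- enum 'I_(r.*2.+1)].
have x_inj : injective x.
  move=> i j ij; apply/val_inj.
  have [/andP[i1 i2] _] := xP i; have [/andP[j1 j2] _] := xP j.
  rewrite ij in i1 i2; have := lt_trans i1 j2; have := lt_trans j1 i2.
  by rewrite !ltr_nat /=; lia.
have urs : uniq rs by rewrite map_inj_uniq ?enum_uniq.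
have charE : char_poly (loop_cycle R r) = \prod_(z <- rs) ('X - z%:P).
  rewrite (all_roots_prod_XsubC (p := char_poly _) (rs := rs)).
  - by rewrite (eqP (char_poly_monic _)) scale1r.
  - by rewrite size_char_poly size_map size_enum_ord.
  - apply/allP => z /mapP[i _ ->]; rewrite -eigenvalue_root_char.
    by apply: loop_cycle_eigenvalue; case: (xP i).
  - by rewrite uniq_rootsE.
split; first exact: loop_cycle_nonneg.
- by apply/diagonalizableP; exists rs; rewrite // -charE mxminpoly_dvd_char.
- move=> a; rewrite eigenvalue_root_char charE root_prod_XsubC => /mapP[i _ ->].
  have [/andP[ix _] _] := xP i; exact: le_trans (ler0n _ _) (ltW ix).
Qed.

(** A walk from vertex 0 must leave it at once, as there is no loop, and then advances by at most
    one per step; in k < n steps it ends among 1, .., k. Treating the whole column makes the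
    induction work. *)
Lemma loop_cycle_exp_eq0 (R : realType) (r k : nat) (i : 'I_(r.*2.+1)) :
  (0 < k <= r.*2)%N -> ~~ (0 < i <= k)%N -> (loop_cycle R r ^+ k) i ord0 = 0.
Proof.
case: k => // k /=; elim: k i => [|k IHk] i kr ik.
  rewrite expr1 mxE mul0rn add0r; case: (eqVneq i (ordS ord0)) => // iS.
  by move: ik; rewrite iS /= modn_small.
rewrite exprS mxE big1 // => l _.
have [lk|lk] := boolP (0 < l <= k.+1)%N; last first.
  by rewrite [X in _ * X]IHk ?mulr0 // ltnW.
rewrite mxE; case: (eqVneq i l) => [il|_]; first by move: ik; rewrite il; lia.
case: (eqVneq i (ordS l)) => [il|_]; last by rewrite addr0 mul0r.
by move: ik; rewrite il /= modn_small; lia.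
Qed.

Lemma loop_cycle_step (R : realType) (r : nat) (j : 'I_(r.*2.+1)) :
  0 < loop_cycle R r (ordS j) j.
Proof.
rewrite mxE eqxx ltr_wpDl ?mulrn_wge0 //.
by case: ifP; rewrite ?invr_gt0.
Qed.

Lemma loop_cycle_path (R : realType) (r k : nat) (i j : 'I_(r.*2.+1)) :
  i = (j + k)%N :> nat -> 0 < (loop_cycle R r ^+ k) i j.
Proof.
have A0 := @loop_cycle_nonneg R r.
elim: k i => [|k IHk] i ijk.
  by rewrite (_ : i = j) ?mxE ?eqxx //; apply/val_inj; rewrite /= ijk addn0.
have lk : (j + k < r.*2.+1)%N by have := ltn_ord i; lia.
rewrite -[k.+1]add1n; apply: (@exp_gt0_trans _ _ _ _ _ _ (Ordinal lk)) => //; last exact: IHk.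
rewrite expr1 (_ : i = ordS (Ordinal lk)) ?loop_cycle_step //.
by apply/val_inj; rewrite /= modn_small -addnS -ijk.
Qed.

Lemma loop_cycle_loop (R : realType) (r k : nat) :
  0 < (loop_cycle R r ^+ k) ord_max ord_max.
Proof.
have A0 := @loop_cycle_nonneg R r.
elim: k => [|k IHk]; first by rewrite mxE eqxx.
rewrite -[k.+1]add1n; apply: (@exp_gt0_trans _ _ _ _ _ _ ord_max) => //; rewrite expr1.
(* For r = 0 the loop weight is 0, but the only arc of the cycle is itself a loop. *)
case: r {IHk} A0 => [|r] A0.
  by have := @loop_cycle_step R 0 ord_max; rewrite (_ : ordS _ = ord_max) //; apply/val_inj.
by rewrite mxE eqxx ltr_wpDr ?mulrn_wge0 ?ltr0n //; case: ifP.
Qed.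

(** A walk of length 2n from j to i: go to the last vertex, wait on its loop, step to 0, go on to i.
    The waiting time n + j - i is never negative. *)
Lemma loop_cycle_exp_pos (R : realType) (r : nat) :
  pos_mx (loop_cycle R r ^+ (r.*2.+1).*2).
Proof.
move=> i j; have A0 := @loop_cycle_nonneg R r.
have ir := ltn_ord i; have jr := ltn_ord j.
have -> : (r.*2.+1).*2 = (i + (1 + ((r.*2.+1 + j - i) + (r.*2 - j))))%N by lia.
apply: (@exp_gt0_trans _ _ _ _ _ _ ord0) => //; first exact: loop_cycle_path.
apply: (@exp_gt0_trans _ _ _ _ _ _ ord_max) => //.
  rewrite expr1 (_ : ord0 = ordS ord_max) ?loop_cycle_step //.
  by apply/val_inj; rewrite /= modnn.
apply: (@exp_gt0_trans _ _ _ _ _ _ ord_max) => //; first exact: loop_cycle_loop.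
by apply: loop_cycle_path => /=; lia.
Qed.

Unset Implicit Arguments.

Theorem proposition4p4 (R : realType) (n : nat) (hn : odd n) :
  exists (MIP : nat) (CE : R),
    [/\ is_MIP R n MIP, is_CE n CE, (n - 1 < MIP)%N & n%:R - 1 <= CE].
Proof.
have [r nE] : exists r, n = r.*2.+1 by exists n./2; lia.
subst n => {hn}; set A := loop_cycle R r.
have GA : GDN A := loop_cycle_GDN R r.
have A2 : pos_mx (A ^+ (r.*2.+1).*2) := @loop_cycle_exp_pos R r.
have prA : primitive_mx A.
  by split; [case: GA | exists (r.*2.+1).*2].
have A0 k : (0 < k < r.*2.+1)%N -> (A ^+ k) ord0 ord0 = 0.
  by move=> kr; apply: loop_cycle_exp_eq0.
have [k kA] := primitivity_index_exists prA.
have [M MP] := MIP_exists GA prA kA.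
have [m mP] := CE_exists R r.*2.+1.
exists M, m; split=> //.
- apply: leq_trans (proj2 MP _ _ GA prA kA); have [k0 Ak _] := kA.
  rewrite subn1 /= ltnNge; apply/negP => kr.
  by have := Ak ord0 ord0; rewrite A0 ?ltxx // k0.
(* For n = 1 the claim is the nonnegativity contained in [CE_bound]. *)
- have [->|r0] := posnP r; first by rewrite subrr; case: mP => [[]].
  apply: (@CE_bound_ge _ _ A ord0 ord0 (r.*2.+1).*2) => //; last by case: mP.
    by rewrite ltnS double_gt0.
  by rewrite gt_eqF.
Qed.
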